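(* Let $L$ be a vector lattice with the projection property. Let $E$ and $F$ be order continuous positive idempotent operators on $L$ such that $EF \ge FE$. Then $(EF)^2 E = EFE$ and $(FE)^2 F = FEF$, and so the unital algebra $\mathcal{A}$ generated by $E$ and $F$ is equal to the linear span of the set $$\{I, E, F, EF, FE, EFE, FEF, (EF)^2, (FE)^2\}.$$ In particular, the dimension of $\mathcal{A}$ is at most $9$.
   Context: Operators are linear. An operator $T$ on a vector lattice $L$ is positive ($T\ge 0$) if it maps the positive cone $L^+$ into itself, and $S \ge T$ means that $S - T$ is positive. $T$ is idempotent if $T^2 = T$. $T$ is order continuous if it maps every net order converging to zero to a net order converging to zero. For $S \subseteq L$, $S^d = \{x \in L : |x| \wedge |y| = 0 \text{ for all } y \in S\}$. A band $B$ of $L$ is a projection band if $L = B \oplus B^d$; $L$ has the projection property if every band of $L$ is a projection band. $I$ is the identity operator. *)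

(* Defs.v *)
From HB Require Import structures.
From mathcomp Require Import all_boot all_order all_algebra.
From mathcomp Require Import all_classical all_reals.

Set Implicit Arguments.
Unset Strict Implicit.
Unset Printing Implicit Defensive.

Import Order.TTheory GRing.Theory Num.Theory.
Local Open Scope classical_set_scope.
Local Open Scope ring_scope.

(* Suprema and infima are fields of the mixin because Hierarchy-Builder rejects
   a join of [GRing.Lmodule] with [Order.Lattice]: both are also inherited by
   [Num.RealDomain], without an intermediate structure. *)
HB.mixin Record Lmodule_POrder_isRiesz (R : realType) L
    of GRing.Lmodule R L & Order.POrder ring_display L := {
  rjoin : L -> L -> L;
  rmeet : L -> L -> L;
  rjoin_lub : forall x y z : L, (rjoin x y <= z) = (x <= z) && (y <= z);
  rmeet_glb : forall x y z : L, (z <= rmeet x y) = (z <= x) && (z <= y);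
  rieszD2r : forall x y z : L, x <= y -> x + z <= y + z;
  rieszZ_ge0 : forall (a : R) (x : L), 0 <= a -> 0 <= x -> 0 <= a *: x
}.

#[short(type="rieszType")]
HB.structure Definition Riesz (R : realType) :=
  { L of Lmodule_POrder_isRiesz R L & GRing.Lmodule R L
       & Order.POrder ring_display L }.

(* The modulus, with values in [L]; the notation [`|x|] is not available since
   it belongs to [normedZmodType]. *)
Definition rabs (R : realType) (L : rieszType R) (x : L) : L := rjoin x (- x).

Record directedSet := DirectedSet {
  dir_sort :> Type;
  dir_le : dir_sort -> dir_sort -> Prop;
  dir_inhabited : inhabited dir_sort;
  dir_refl : forall a, dir_le a a;
  dir_trans : forall b a c, dir_le a b -> dir_le b c -> dir_le a c;
  dir_ub : forall a b, exists c, dir_le a c /\ dir_le b c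
}.

Section RieszTheory.
Variables (R : realType) (L : rieszType R).

(* [y] is decreasing with infimum [0]. *)
Definition decreases_to0 (B : directedSet) (y : B -> L) : Prop :=
  [/\ forall b b', dir_le b b' -> y b' <= y b,
      forall b, 0 <= y b
    & forall z, (forall b, z <= y b) -> z <= 0].

(* The dominating net may have an index set of its own, and domination is only
   required eventually, so that convergence depends only on the tails of [x]. *)
Definition order_cvg (A : directedSet) (x : A -> L) (l : L) : Prop :=
  exists (B : directedSet) (y : B -> L), decreases_to0 y /\
    forall b, exists a0, forall a, dir_le a0 a -> rabs (x a - l) <= y b.

Definition order_continuous (T : L -> L) : Prop :=
  forall (A : directedSet) (x : A -> L),
    order_cvg x 0 -> order_cvg (T \o x) 0.

Definition positive_op (T : L -> L) : Prop := forall x, 0 <= x -> 0 <= T x.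

Definition op_ge (S T : L -> L) : Prop := positive_op (S - T).

Definition disjoint_compl (S : set L) : set L :=
  [set x | forall y, S y -> rmeet (rabs x) (rabs y) = 0].

End RieszTheory.

Section Linear.
Variables (R : realType) (V : lmodType R).

Definition is_subspace (A : set V) : Prop :=
  A 0 /\ forall (a : R) u v, A u -> A v -> A (a *: u + v).

Definition linear_span (S : set V) : set V := smallest is_subspace S.

Definition lin_indep (n : nat) (v : 'I_n -> V) : Prop :=
  forall c : 'I_n -> R, \sum_(i < n) c i *: v i = 0 -> forall i, c i = 0.

Definition has_dim (A : set V) (n : nat) : Prop :=
  exists v : 'I_n -> V, lin_indep v /\ linear_span (range v) = A.

End Linear.

Section Bands.
Variables (R : realType) (L : rieszType R).

Definition is_ideal (B : set L) : Prop :=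
  is_subspace B /\ forall x y, rabs x <= rabs y -> B y -> B x.

Definition order_closed (B : set L) : Prop :=
  forall (A : directedSet) (x : A -> L) (l : L),
    (forall a, B (x a)) -> order_cvg x l -> B l.

Definition is_band (B : set L) : Prop := is_ideal B /\ order_closed B.

(* Both [B] and [disjoint_compl B] are subspaces, so this is [L = B (+) B^d]. *)
Definition is_projection_band (B : set L) : Prop :=
  is_band B /\
  (forall x, exists b c, [/\ B b, disjoint_compl B c & x = b + c]) /\
  B `&` disjoint_compl B = [set 0].

End Bands.

Definition projection_property (R : realType) (L : rieszType R) : Prop :=
  forall B : set L, is_band B -> is_projection_band B.

(* Operators are elements of the [R]-module [L -> L], with composition as
   product. Subalgebras generated by linear maps consist of linear maps. *)
Definition is_unital_subalgebra (R : realType) (L : lmodType R)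
    (A : set (L -> L)) : Prop :=
  [/\ is_subspace A, A idfun & forall S T, A S -> A T -> A (S \o T)].

Definition generated_algebra (R : realType) (L : lmodType R)
    (E F : {linear L -> L}) : set (L -> L) :=
  smallest (@is_unital_subalgebra R L) [set (E : L -> L); (F : L -> L)].

(* Main.v *)
(* Multiplying [EF >= FE] on either side by [E] or [F] gives
   [EF >= EFE >= FE] and [EF >= FEF >= FE].  Hence
   [EFE = (EF)(FE) >= (EFE)(FE) = E(FEF)E >= E(FE)E = EFE], and likewise
   [FEF = F(EF)F >= F(EFE)F >= F(FE)F = FEF].  The positive cone generates [L],
   so both chains collapse to equalities of operators. *)
Require Import Defs.
From HB Require Import structures.
From mathcomp Require Import all_boot all_order all_algebra.
From mathcomp Require Import all_classical all_reals.

Set Implicit Arguments.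
Unset Strict Implicit.
Unset Printing Implicit Defensive.

Import Order.TTheory GRing.Theory Num.Theory.
Local Open Scope classical_set_scope.
Local Open Scope ring_scope.

Section RieszOperators.
Variables (R : realType) (L : rieszType R).
Implicit Types (x y : L).

Lemma riesz_subr_ge0 x y : (0 <= y - x) = (x <= y).
Proof.
apply/idP/idP => [/(fun h => rieszD2r _ _ x h)|/(fun h => rieszD2r _ _ (- x) h)].
  by rewrite add0r subrK.
by rewrite subrr.
Qed.

Lemma op_geP (S T : L -> L) :
  op_ge S T <-> (forall x, 0 <= x -> T x <= S x).
Proof.
by split=> + x x0 => /(_ x x0); rewrite -riesz_subr_ge0.
Qed.

Lemma positive_op_homo (T : {linear L -> L}) :
  positive_op T -> {homo T : x y / x <= y}.
Proof.
by move=> T0 x y; rewrite -riesz_subr_ge0 => /T0; rewrite linearB riesz_subr_ge0.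
Qed.

(** The positive cone generates [L]: with [p = rjoin x 0], the vector [x = p - (p - x)] is a
    difference of two positive vectors. *)
Lemma linear_ext_ge0 (S T : {linear L -> L}) :
  (forall x, 0 <= x -> S x = T x) -> S = T :> (L -> L).
Proof.
move=> ST; apply/funext => x.
have /andP[xp p0] : (x <= rjoin x 0) && (0 <= rjoin x 0) by rewrite -rjoin_lub.
have q0 : 0 <= rjoin x 0 - x by rewrite riesz_subr_ge0.
by rewrite -[x](subKr (rjoin x 0)) [LHS]linearB [RHS]linearB !ST.
Qed.

Section IdempotentPair.
Variables E F : {linear L -> L}.
Hypotheses (posE : positive_op E) (posF : positive_op F).
Hypotheses (idE : idempotent_fun E) (idF : idempotent_fun F).
Hypothesis hEF : op_ge (E \o F) (F \o E).

Let EE x : E (E x) = E x. Proof. exact: idE. Qed.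
Let FF x : F (F x) = F x. Proof. exact: idF. Qed.
Let FE_le_EF x : 0 <= x -> F (E x) <= E (F x).
Proof. by move: x; apply/op_geP. Qed.

(** On the cone, swapping one factor [FE] gives each bound: [E(FE)FE <= E(EF)FE = EFE] and
    [EFE = EF(FE)E <= EF(EF)E]. *)
Lemma EFEFE_eq_EFE : (E \o F) \o (E \o F) \o E = E \o F \o E :> (L -> L).
Proof.
apply: (@linear_ext_ge0 (E \o F \o E \o F \o E : {linear L -> L})
                        (E \o F \o E : {linear L -> L})) => x x0 /=.
have Ex0 := posE x0; apply/le_anti/andP; split.
  have := positive_op_homo posE (FE_le_EF (posF Ex0)).
  by rewrite EE FF.
have := positive_op_homo posE (positive_op_homo posF (FE_le_EF Ex0)).
by rewrite EE FF.
Qed.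

(** Exchanging [E] and [F] would reverse [hEF], so the swaps fall elsewhere:
    [FE(FE)F <= FE(EF)F = FEF] and [FEF = F(FE)EF <= F(EF)EF]. *)
Lemma FEFEF_eq_FEF : (F \o E) \o (F \o E) \o F = F \o E \o F :> (L -> L).
Proof.
apply: (@linear_ext_ge0 (F \o E \o F \o E \o F : {linear L -> L})
                        (F \o E \o F : {linear L -> L})) => x x0 /=.
have Fx0 := posF x0; apply/le_anti/andP; split.
  have := positive_op_homo posF (positive_op_homo posE (FE_le_EF Fx0)).
  by rewrite EE FF.
have := positive_op_homo posF (FE_le_EF (posE Fx0)).
by rewrite EE FF.
Qed.

End IdempotentPair.
End RieszOperators.

Section LinearSpan.
Variables (R : realType) (V : lmodType R).
Implicit Types (A S : set V).

Lemma is_subspaceD A u v : is_subspace A -> A u -> A v -> A (u + v).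
Proof. by move=> [_ Al] Au Av; rewrite -[u]scale1r; exact: Al. Qed.

Lemma is_subspaceZ A (a : R) u : is_subspace A -> A u -> A (a *: u).
Proof. by move=> [A0 Al] Au; rewrite -[X in A X]addr0; exact: Al. Qed.

Lemma is_subspace_sum A (I : finType) (P : pred I) (f : I -> V) :
  is_subspace A -> (forall i, P i -> A (f i)) -> A (\sum_(i | P i) f i).
Proof.
move=> sA Af; apply: big_ind Af; first by case: sA.
by move=> u v; exact: is_subspaceD.
Qed.

Lemma is_subspace_linear_span S : is_subspace (linear_span S).
Proof.
split=> [B [[B0 _] _] //|a u v Su Sv B BS].
by case: (BS) => -[_ Bl] _; apply: Bl; [exact: Su|exact: Sv].
Qed.

Lemma linear_span_min S A :
  is_subspace A -> S `<=` A -> linear_span S `<=` A.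
Proof. by move=> sA SA; exact: smallest_sub. Qed.

Lemma sub_linear_span S : S `<=` linear_span S.
Proof. exact: sub_gen_smallest. Qed.

(** Induction on the length of the family: a dependent family can lose one member without changing
    its span. *)
Lemma has_dim_linear_span_range n (v : 'I_n -> V) :
  exists m, (m <= n)%N /\ has_dim (linear_span (range v)) m.
Proof.
elim: n v => [|n IHn] v.
  by exists 0%N; split=> //; exists v; split=> // c _ [].
have [vfree|vdep] := pselect (lin_indep v).
  by exists n.+1; split=> //; exists v.
have [c [cv0 [i ci0]]] : exists c : 'I_n.+1 -> R,
    \sum_(i < n.+1) c i *: v i = 0 /\ exists i, c i <> 0.
  apply: contrapT => nex; apply: vdep => c cv0 i.
  by apply: contrapT => ci0; apply: nex; exists c; split=> //; exists i.
(* [lift i] enumerates the indices other than [i], so this family is [v] with the redundant [v i]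
   removed. *)
have [m [mn dimm]] := IHn (v \o lift i).
exists m; split; first exact: leqW.
suff -> : linear_span (range v) = linear_span (range (v \o lift i)) by [].
have sW := is_subspace_linear_span (range (v \o lift i)).
have Wv j : j != i -> linear_span (range (v \o lift i)) (v j).
  rewrite eq_sym => /unlift_some[k -> _].
  by apply: sub_linear_span; exists k.
apply/seteqP; split; last first.
  apply: linear_span_min; first exact: is_subspace_linear_span.
  by move=> _ [k _ <-]; apply: sub_linear_span; exists (lift i k).
apply: linear_span_min => // _ [j _ <-].
have [->|] := eqVneq j i; last exact: Wv.
(* The dependence relation is solved for [v i], since [c i] is invertible. *)
have -> : v i = - (c i)^-1 *: \sum_(k < n.+1 | k != i) c k *: v k.
  move: cv0; rewrite (bigD1 i) //= => /eqP; rewrite addrC addr_eq0 => /eqP ->.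
  by rewrite scalerN scaleNr opprK scalerA mulVf ?scale1r//; exact/eqP.
apply: (is_subspaceZ _ sW); apply: (is_subspace_sum sW) => k ki.
by apply: (is_subspaceZ _ sW); exact: Wv.
Qed.

Lemma has_dim_linear_span_seq (s : seq V) :
  exists m, (m <= size s)%N /\ has_dim (linear_span [set` s]) m.
Proof.
have -> : [set` s] = range (fun i : 'I_(size s) => s`_i); last first.
  exact: has_dim_linear_span_range.
apply/seteqP; split=> [x /= xs|_ [i _ <-] /=]; last exact: mem_nth.
have ltxs : (index x s < size s)%N by rewrite index_mem.
by exists (Ordinal ltxs); rewrite //= nth_index.
Qed.

Lemma set_cons (x : V) (s : seq V) : [set` x :: s] = x |` [set` s].
Proof.
by apply/seteqP; split=> y /=; rewrite inE => /predU1P.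
Qed.

End LinearSpan.

Section SpanSubalgebra.
Variables (R : realType) (L : lmodType R).

(** Composition is bilinear when the left factor is linear, so closure extends from [S] to its span
    one factor at a time, the right factor first. *)
Lemma is_unital_subalgebra_linear_span (S : set (L -> L)) :
  S idfun -> (forall f, S f -> linear f) ->
  (forall f g, S f -> S g -> S (f \o g)) ->
  is_unital_subalgebra (linear_span S).
Proof.
move=> S1 Slin Scomp; have sS := is_subspace_linear_span S.
have left_comp f : S f -> linear_span S `<=` [set g | linear_span S (f \o g)].
  move=> Sf; apply: linear_span_min => [|g Sg /=]; last first.
    by apply: sub_linear_span; exact: Scomp.
  have flin := Slin f Sf; split=> [|a u v fu fv] /=.
    have -> : f \o 0 = 0 :> (L -> L); last by case: sS.
    apply/funext => x /=.
    (* Linearity at [-1, 0, 0] reads [f 0 = - f 0 + f 0]. *)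
    by have := flin (-1) 0 0; rewrite scaler0 addr0 scaleN1r addNr.
  have -> : f \o (a *: u + v) = a *: (f \o u) + (f \o v).
    by apply/funext => x /=; exact: flin.
  by case: sS => _ Sl; exact: Sl.
split=> // [|f g Sf Sg]; first exact: sub_linear_span.
(* Now [g] is any element of the span; [h |-> h \o g] is linear because operations on functions are
   pointwise. *)
suff : linear_span S `<=` [set h : L -> L | linear_span S (h \o g)].
  by move=> /(_ f Sf).
apply: linear_span_min => [|h Sh /=]; last exact: (left_comp h Sh).
case: sS => S0 Sl.
by split=> // a u v; exact: (Sl a (u \o g) (v \o g)).
Qed.

Lemma is_unital_subalgebra_generated (E F : {linear L -> L}) :
  is_unital_subalgebra (generated_algebra E F).
Proof.
split=> [|A [[_ A1 _] _] //|S T gS gT A hA].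
  split=> [A [[[A0 _] _ _] _] //|a u v gu gv A hA].
  by case: (hA) => -[[_ Al] _ _] _; apply: Al; [exact: gu|exact: gv].
by case: (hA) => -[_ _ Ac] _; apply: Ac; [exact: gS|exact: gT].
Qed.

End SpanSubalgebra.

(** Tries the words of a left-nested union from last to first, comparing pointwise after reduction
    by [rules]. The second alternative is for the innermost singleton, where no [right] is left to
    take. *)
Ltac mem_words rules :=
  first [ by right; apply/funext => x /=; rewrite ?rules
        | by apply/funext => x /=; rewrite ?rules
        | left; mem_words rules ].

Theorem theorem4p4 (R : realType) (L : rieszType R) (E F : {linear L -> L})
    (hL : projection_property L)
    (ocE : order_continuous E) (ocF : order_continuous F)
    (posE : positive_op E) (posF : positive_op F)
    (idE : idempotent_fun E) (idF : idempotent_fun F)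
    (hEF : op_ge (E \o F) (F \o E)) :
  [/\ (E \o F) \o (E \o F) \o E = E \o F \o E :> (L -> L),
      (F \o E) \o (F \o E) \o F = F \o E \o F :> (L -> L),
      generated_algebra E F =
        linear_span [set (idfun : L -> L); (E : L -> L); (F : L -> L);
                         E \o F; F \o E; E \o F \o E; F \o E \o F;
                         (E \o F) \o (E \o F); (F \o E) \o (F \o E)]
    & exists n : nat, (n <= 9)%N /\ has_dim (generated_algebra E F) n].
Proof.
have hE := EFEFE_eq_EFE posE posF idE idF hEF.
have hF := FEFEF_eq_FEF posE posF idE idF hEF.
set S := [set _; _; _; _; _; _; _; _; _].
have EE x : E (E x) = E x := idE x.
have FF x : F (F x) = F x := idF x.
have EFE x : E (F (E (F (E x)))) = E (F (E x)) := congr1 (@^~ x) hE.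
have FEF x : F (E (F (E (F x)))) = F (E (F x)) := congr1 (@^~ x) hF.
(* Every word in [S] arises from the identity by multiplying on the left by [E] or [F]; regroupings
   of composites are convertible. *)
have S_ind (P : (L -> L) -> Prop) : P idfun ->
    (forall f, P f -> P (E \o f)) -> (forall f, P f -> P (F \o f)) ->
    forall f, S f -> P f.
  move=> P1 PE PF.
  have pE : P E := PE _ P1.
  have pF : P F := PF _ P1.
  have pEF : P (E \o F) := PE _ pF.
  have pFE : P (F \o E) := PF _ pE.
  have pEFE : P (E \o F \o E) := PE _ pFE.
  have pFEF : P (F \o E \o F) := PF _ pEF.
  have pEFEF : P ((E \o F) \o (E \o F)) := PE _ pFEF.
  have pFEFE : P ((F \o E) \o (F \o E)) := PF _ pEFE.
  by move=> f [[[[[[[[|]|]|]|]|]|]|]|] ->.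
(* The two collapsed relations enter here: [E] times [FEFE] is [EFE] again, and dually for [F]. With
   [S_ind], this makes [S] the monoid generated by [E] and [F]. *)
have SE f : S f -> S (E \o f).
  by move=> [[[[[[[[|]|]|]|]|]|]|]|] ->; mem_words (EE, FF, EFE, FEF).
have SF f : S f -> S (F \o f).
  by move=> [[[[[[[[|]|]|]|]|]|]|]|] ->; mem_words (EE, FF, EFE, FEF).
have S1 : S idfun by do 8 left.
have gen_span : generated_algebra E F = linear_span S.
  have [sg g1 gc] := is_unital_subalgebra_generated E F.
  apply/seteqP; split; last first.
    apply: linear_span_min => //; apply: S_ind => // f; apply: gc => A [_].
      by apply; left.
    by apply; right.
  (* By minimality it remains that the span of [S] is a unital subalgebra containing
     [E = E \o idfun] and [F = F \o idfun]. *)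
  apply: smallest_sub => [|f [] ->]; last 2 first.
  - by apply: sub_linear_span; exact: (SE idfun).
  - by apply: sub_linear_span; exact: (SF idfun).
  apply: is_unital_subalgebra_linear_span => //.
    apply: S_ind => // f flin a u v /=; by rewrite flin linearP.
  (* Induction on the left factor reduces closure under composition to [SE] and [SF]. *)
  move=> f g + Sg; move: f; apply: S_ind => // f; [exact: SE|exact: SF].
split=> //; rewrite gen_span.
pose words : seq (L -> L) := [:: idfun : L -> L; E : L -> L; F : L -> L;
  E \o F; F \o E; E \o F \o E; F \o E \o F;
  (E \o F) \o (E \o F); (F \o E) \o (F \o E)].
(* Listing the nine words bounds the dimension by the length of the list, even if some words
   coincide as operators. *)
have -> : S = [set` words] by rewrite !set_cons set_nil setU0 !setUA.
exact: (has_dim_linear_span_seq words).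
Qed.
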